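(* There exists an irrational number $\alpha\in[0,1]$ such that the sequences $\{b_n\}_{n\ge1}$ and $\{c_n\}_{n\ge1}$ produced by Shulga's algorithm applied to $\alpha$ (the partial quotients of its Shulga decomposition $\alpha=\beta+\gamma$) satisfy, for every $n\ge1$, $$4n-2\le b_n<c_n<5n.$$
   Context: Continued fractions: $[a_0;a_1,a_2,\ldots]=a_0+\cfrac{1}{a_1+\cfrac{1}{a_2+\cdots}}$ with $a_0\in\mathbb{Z}$ and positive integers $a_i$ ($i\ge1$). For rational numbers one uses the finite expansion whose last partial quotient is greater than $1$, except that for the number $1$ one uses $1=[0;1]$, i.e. $a_1(1)=1$. $a_n(x)$ denotes the $n$th partial quotient of $x$ (undefined if $n$ exceeds the length of the expansion). An empty list of partial quotients gives $[0;\,]=0$. Shulga's algorithm for $\alpha\in[0,1]$: for $n=0,1,2,\ldots$, suppose $b_k,c_k$ are defined for $1\le k\le n$. If $\alpha=[0;b_1,\ldots,b_n]+[0;c_1,\ldots,c_n]$, put $\beta=[0;b_1,\ldots,b_n]$, $\gamma=[0;c_1,\ldots,c_n]$ and stop. Otherwise define $$b_{n+1}=a_{n+1}(\alpha-[0;c_1,\ldots,c_n])+1,\qquad c_{n+1}=a_{n+1}(\alpha-[0;b_1,\ldots,b_n,b_{n+1}]).$$ If the algorithm never stops (in particular for every irrational $\alpha$), put $\beta=[0;b_1,b_2,\ldots]$, $\gamma=[0;c_1,c_2,\ldots]$. It is known (Shulga) that these quantities are always well defined and that $\alpha=\beta+\gamma$; this is called the Shulga decomposition of $\alpha$. *)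

(* Defs.v *)
From mathcomp Require Import all_boot all_order all_algebra.
From mathcomp Require Import all_classical all_reals all_analysis.

Set Implicit Arguments.
Unset Strict Implicit.
Unset Printing Implicit Defensive.

Import Order.TTheory GRing.Theory Num.Theory.
Import numFieldNormedType.Exports.

Local Open Scope classical_set_scope.
Local Open Scope ring_scope.

(* [0; s_1, ..., s_n]; in particular [0; ] = 0. *)
Fixpoint cfrac (R : realType) (s : seq nat) : R :=
  if s is a :: s' then (a%:R + cfrac R s')^-1 else 0.

(* Sequences of partial quotients are indexed from 1: the value at 0 is never
   read. *)
Definition cfrac_upto (R : realType) (a : nat -> nat) (n : nat) : R :=
  cfrac R [seq a i | i <- iota 1 n].

(* x = [a0; s_1, ..., s_n] in the normalized form: the last partial quotient
   exceeds 1 (no condition for an integer [a0; ]), except that the number 1 is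
   written [0; 1]. *)
Definition finite_expansion (R : realType) (x : R) (a0 : int) (s : seq nat) :
    Prop :=
  [/\ x = a0%:~R + cfrac R s,
      all (fun a => 0 < a)%N s &
      if x == 1 then a0 = 0 /\ s = [:: 1%N] else (1 < last 2 s)%N].

Definition infinite_expansion (R : realType) (x : R) (a0 : int)
    (a : nat -> nat) : Prop :=
  (forall i, (0 < i)%N -> (0 < a i)%N) /\
  a0%:~R + cfrac_upto R a n @[n --> \oo] --> x.

(* The partial quotient a_n(x), for n >= 1, is defined and equal to k. *)
Definition partial_quotient (R : realType) (x : R) (n k : nat) : Prop :=
  (exists a0 s, finite_expansion x a0 s /\
     [/\ (0 < n)%N, (n <= size s)%N & nth 0%N s n.-1 = k]) \/
  (exists a0 a, infinite_expansion x a0 a /\ (0 < n)%N /\ a n = k).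

(* Shulga's algorithm applied to alpha never stops and produces the infinite
   sequences b_1, b_2, ... and c_1, c_2, ... *)
Definition shulga_sequences (R : realType) (alpha : R) (b c : nat -> nat) :
    Prop :=
  forall n : nat,
    [/\ alpha <> cfrac_upto R b n + cfrac_upto R c n,
        exists2 k, partial_quotient (alpha - cfrac_upto R c n) n.+1 k
                 & b n.+1 = k.+1 &
        partial_quotient (alpha - cfrac_upto R b n.+1) n.+1 (c n.+1)].

(* Main.v *)
Require Import Defs.
From mathcomp Require Import all_boot all_order all_algebra.
From mathcomp Require Import all_classical all_reals all_analysis.
From mathcomp Require Import ring lra zify.

Set Implicit Arguments.
Unset Strict Implicit.
Unset Printing Implicit Defensive.

Import Order.TTheory GRing.Theory Num.Theory.
Import numFieldNormedType.Exports.

Local Open Scope classical_set_scope.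
Local Open Scope ring_scope.

(** The number is alpha = beta + gamma with beta = [0; b_1, b_2, ...] and
    gamma = [0; c_1, c_2, ...] for an explicit pair of sequences. Let beta_n
    and gamma_n be the convergents and q_n, Q_n their denominators. The errors
    beta - beta_n and gamma - gamma_n both have the sign of (-1)^n.

    The algorithm reads b_(n+1) - 1 from alpha - gamma_n, which is beta moved
    by the error of gamma_n, and c_(n+1) from alpha - beta_(n+1), which is
    gamma moved by the error of beta_(n+1). The numbers whose expansion begins
    with given quotients form an explicit interval
    (partial_quotient_of_bounds), so the algorithm returns the two sequences
    as soon as these displacements stay within certain bounds;
    shulga_sequences_of_bounds reduces them to two inequalities between
    denominators. With r_n = (Q_n/q_n)^2 the inequalities read, up to
    lower-order terms,

      b_(n+1) - d_(n+1) - 2 < r_n < b_(n+1) - 2,   d_n = c_n - b_n.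

    The choice b_(n+1) = floor(r_n) + 3 satisfies them both for d_(n+1) = 3 and,
    with the help of the tail of beta, for d_(n+1) = 2 (quotb_margin3,
    quotb_margin2, quotc_margin). Since r_(n+1) is about
    r_n * (c_(n+1)/b_(n+1))^2, which is about r_n + 2 d_(n+1), taking d = 3
    when r_n is below 4n + 1 and d = 2 otherwise keeps 4n - 1 <= r_n < 5n
    (sq_ratio_itv), and the bounds on b_n and c_n follow. The first two pairs
    are chosen by hand so that r_2 is in this range.

    Finally, alpha - beta_n - gamma_n is not zero, and after multiplication by
    q_n Q_n it is of order 1/sqrt(r_n), which tends to 0. For a rational alpha
    it would be bounded below, so alpha is irrational (irrational_sum_cf). *)

(** * Continued fractions with positive quotients *)

Definition pos_quotients (a : nat -> nat) := forall i, (0 < i)%N -> (0 < a i)%N.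

Definition shift (n : nat) (a : nat -> nat) : nat -> nat := fun i => a (n + i)%N.

(** Numerators and denominators of the convergents obey one and the same
    two-term recurrence with different initial values; carrying the pair of
    consecutive values makes index -1 available without a special case, so
    that den_prev a 0 = 0 and numer_prev a 0 = 1. *)
Fixpoint continuant_pair (a : nat -> nat) (u v n : nat) : nat * nat :=
  if n is m.+1 then
    let p := continuant_pair a u v m in (p.2, (a n * p.2 + p.1)%N)
  else (u, v).

Definition den a n := (continuant_pair a 0 1 n).2.
Definition den_prev a n := (continuant_pair a 0 1 n).1.
Definition numer a n := (continuant_pair a 1 0 n).2.
Definition numer_prev a n := (continuant_pair a 1 0 n).1.

Lemma denS a n : den a n.+1 = (a n.+1 * den a n + den_prev a n)%N.
Proof. by []. Qed.

Lemma den_prevS a n : den_prev a n.+1 = den a n.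
Proof. by []. Qed.

Lemma pos_quotients_shift a n : pos_quotients a -> pos_quotients (shift n a).
Proof. by move=> ha [//|i] _; apply: ha; rewrite addnS. Qed.

Lemma den_gt0 a n : pos_quotients a -> (0 < den a n)%N.
Proof.
move=> ha; elim: n => // n IH.
by rewrite denS ltn_addr// muln_gt0 IH ha.
Qed.

(** The linear growth is weak, but it is all that the convergence of the
    convergents needs. *)
Lemma den_lin a n : pos_quotients a -> (n < 2 * den a n)%N.
Proof.
move=> ha.
have h : (n <= den a n)%N.
  elim: n => // -[|n] IH; first exact: den_gt0.
  rewrite denS den_prevS.
  have := den_gt0 n ha; have := ha n.+2 isT; move: IH.
  move: (den a n.+1) (den a n) (a n.+2) => x y z; nia.
have := den_gt0 n ha; lia.
Qed.

Section ContinuedFractions.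
Context {R : realType}.
Implicit Types (a : nat -> nat) (t x : R).

(** The continued fraction [0; a_1, ..., a_n + t]. A real t in place of the
    missing tail lets one formula cover the convergents (t = 0), the
    value of the infinite fraction (t its tail) and the expansions of all
    points close to a convergent. *)
Fixpoint cfrac_with (a : nat -> nat) (n : nat) (t : R) : R :=
  if n is m.+1 then ((a 1%N)%:R + cfrac_with (shift 1 a) m t)^-1 else t.

Lemma cfrac_upto_with a n : cfrac_upto R a n = cfrac_with a n 0.
Proof.
rewrite /cfrac_upto; elim: n a => //= n IH a; rewrite -IH.
congr (_ + cfrac R _)^-1.
by rewrite (iotaDl 1 1 n) -map_comp.
Qed.

Lemma eq_cfrac_with a a' n t : (forall i, a i.+1 = a' i.+1) ->
  cfrac_with a n t = cfrac_with a' n t.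
Proof.
elim: n a a' => //= n IH a a' h; rewrite h; congr (_ + _)^-1.
by apply: IH => i; rewrite /shift add1n h.
Qed.

Lemma cfrac_with_add a n m t :
  cfrac_with a (n + m) t = cfrac_with a n (cfrac_with (shift n a) m t).
Proof.
elim: n a => [|n IH] a.
  exact: eq_cfrac_with.
by rewrite addSn /= IH.
Qed.

Lemma cfrac_with_rcons a n t :
  cfrac_with a n.+1 t = cfrac_with a n ((a n.+1)%:R + t)^-1.
Proof. by rewrite -addn1 cfrac_with_add /= /shift addn1. Qed.

Lemma cfrac_with_itv a n t : pos_quotients a -> 0 <= t <= 1 ->
  0 <= cfrac_with a n t <= 1.
Proof.
elim: n a => //= n IH a ha ht.
have /andP[h0 h1] := IH _ (pos_quotients_shift 1 ha) ht.
have a1 : 1 <= (a 1%N)%:R :> R by rewrite ler1n ha.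
rewrite invr_ge0 invf_le1; lra.
Qed.

Lemma den_gt0R a n : pos_quotients a -> 0 < (den a n)%:R :> R.
Proof. by move=> ha; rewrite ltr0n den_gt0. Qed.

Lemma denSR a n : (den a n.+1)%:R = (a n.+1)%:R * (den a n)%:R + (den_prev a n)%:R :> R.
Proof. by rewrite denS natrD natrM. Qed.

Lemma mobius_den_gt0 a n t : pos_quotients a -> 0 <= t ->
  0 < (den a n)%:R + t * (den_prev a n)%:R.
Proof. by move=> ha ht; rewrite ltr_pwDl ?den_gt0R// mulr_ge0. Qed.

(** Each quotient acts by the Moebius map t -> 1 / (a + t), so n of them act by
    the product of the corresponding matrices, whose entries are the
    numerators and denominators of two consecutive convergents. *)
Lemma cfrac_with_mobius a n t : pos_quotients a -> 0 <= t ->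
  cfrac_with a n t = ((numer a n)%:R + t * (numer_prev a n)%:R) /
                     ((den a n)%:R + t * (den_prev a n)%:R).
Proof.
move=> ha; elim: n t => [|n IH] t t0.
  by rewrite /= /numer /numer_prev /den /den_prev /=; field.
have a1 : 0 < (a n.+1)%:R :> R by rewrite ltr0n ha.
have at0 : 0 < (a n.+1)%:R + t by rewrite ltr_pwDl.
have h := mobius_den_gt0 n.+1 ha t0.
rewrite cfrac_with_rcons IH ?invr_ge0 ?ltW//.
have h' : 0 < (den a n)%:R + ((a n.+1)%:R + t)^-1 * (den_prev a n)%:R.
  by apply: mobius_den_gt0 => //; rewrite invr_ge0 ltW.
rewrite denSR den_prevS /numer /numer_prev /= -/(numer a n) -/(numer_prev a n).
rewrite natrD natrM; rewrite denSR den_prevS in h.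
by field; rewrite ?gt_eqF//=; apply/andP; split; rewrite gt_eqF//; lra.
Qed.

(** The determinant of a product of n matrices of determinant -1. *)
Lemma conv_det a n :
  (numer_prev a n)%:R * (den a n)%:R - (numer a n)%:R * (den_prev a n)%:R
    = (-1) ^+ n :> R.
Proof.
elim: n => [|n IH].
  by rewrite /numer /numer_prev /den /den_prev /= expr0; ring.
rewrite denSR den_prevS exprS -IH /numer /numer_prev /=.
rewrite -/(numer a n) -/(numer_prev a n) natrD natrM; ring.
Qed.

(** By the determinant identity the numerator of the difference of the two
    Moebius values is t up to sign. The sign alternates with n, whatever t is. *)
Lemma cfrac_with_error a n t : pos_quotients a -> 0 <= t ->
  cfrac_with a n t - cfrac_upto R a n =
  (-1) ^+ n * (t / ((den a n)%:R * ((den a n)%:R + t * (den_prev a n)%:R))).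
Proof.
move=> ha ht; have h := mobius_den_gt0 n ha ht; have h' := den_gt0R n ha.
rewrite cfrac_upto_with !cfrac_with_mobius// -(conv_det a n).
by field; rewrite !gt_eqF.
Qed.

Lemma cfrac_with_error_le a n t : pos_quotients a -> 0 <= t <= 1 ->
  `|cfrac_with a n t - cfrac_upto R a n| <= 2 * harmonic n.
Proof.
move=> ha /andP[t0 t1]; rewrite cfrac_with_error// normrM normrX normrN1 expr1n mul1r.
have h := mobius_den_gt0 n ha t0; have h' := den_gt0R n ha.
rewrite ger0_norm; last by rewrite divr_ge0// mulr_ge0// ltW.
rewrite ler_pdivrMr ?mulr_gt0//.
have d1 : 1 <= (den a n)%:R :> R by rewrite ler1n den_gt0.
have p0 : 0 <= t * (den_prev a n)%:R by rewrite mulr_ge0.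
have dn : n.+1%:R <= 2 * (den a n)%:R :> R by rewrite -natrM ler_nat den_lin.
have n0 : 0 < n.+1%:R :> R by rewrite ltr0n.
apply: (le_trans t1); rewrite /harmonic mulrAC ler_pdivlMr// mul1r.
apply: (le_trans dn); rewrite ler_wpM2l// ler_peMr//; lra.
Qed.

Let cvg_twice_harmonic : 2 * harmonic n @[n --> \oo] --> (0 : R).
Proof. by rewrite -[X in _ --> X](mulr0 2); apply: cvgMr; exact: cvg_harmonic. Qed.

(** Infinite expansions are recognised from a sequence of tails: the n-th
    convergent and x are two values of the same Moebius map, at 0 and at w n. *)
Lemma infinite_expansion_of_tails a (w : nat -> R) x : pos_quotients a ->
  (forall n, 0 <= w n <= 1) -> (forall n, x = cfrac_with a n (w n)) ->
  infinite_expansion x 0 a.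
Proof.
move=> ha hw hx; split=> //.
apply/cvgrPdist_le => e e0.
move/cvgrPdist_le : cvg_twice_harmonic => /(_ e e0); apply: filterS => n.
rewrite sub0r normrN => he; rewrite add0r {1}(hx n).
apply: le_trans (cfrac_with_error_le n ha (hw n)) _.
exact: le_trans (ler_norm _) he.
Qed.

Definition cf_value a : R := lim (cfrac_upto R a n @[n --> \oo]).

(** The convergents of index at least N all lie within 2/(N+1) of the N-th one,
    hence form a Cauchy sequence. *)
Lemma cf_value_itv a : pos_quotients a ->
  infinite_expansion (cf_value a) 0 a /\ 0 <= cf_value a <= 1.
Proof.
move=> ha.
have e01 : 0 <= (0:R) <= 1 by rewrite lexx ler01.
have itv n : 0 <= cfrac_upto R a n <= 1.
  by rewrite cfrac_upto_with; exact: cfrac_with_itv.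
have cv : cvg (cfrac_upto R a n @[n --> \oo]).
  apply/cauchy_cvgP/cauchyP => e e0.
  move/cvgrPdist_lt : cvg_twice_harmonic => /(_ e e0) [N _ hN].
  exists (cfrac_upto R a N); exists N => // n /= nN.
  rewrite /ball /= distrC.
  rewrite -(subnKC nN) [X in X - _]cfrac_upto_with cfrac_with_add.
  apply: le_lt_trans (cfrac_with_error_le N ha _) _.
    by apply: cfrac_with_itv => //; exact: pos_quotients_shift.
  have := hN N (leqnn N); rewrite /= sub0r normrN.
  by apply: le_lt_trans; exact: ler_norm.
split; first by split => //; under eq_fun do rewrite add0r.
by apply/andP; split; [apply: limr_ge|apply: limr_le] => //;
  near=> n; case/andP: (itv n).
Unshelve. all: by end_near.
Qed.

Lemma infinite_expansion_cons a g x : pos_quotients a -> 0 <= x ->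
  (forall i, a i.+2 = g i.+1) -> infinite_expansion x 0 g ->
  infinite_expansion ((a 1%N)%:R + x)^-1 0 a.
Proof.
move=> ha x0 hag [_ hc]; split => //.
have a1 : 0 < (a 1%N)%:R :> R by rewrite ltr0n ha.
rewrite -cvg_shiftS /=.
under eq_fun do rewrite add0r cfrac_upto_with /= (eq_cfrac_with _ _ hag) -cfrac_upto_with.
apply: cvgV; first by rewrite gt_eqF// ltr_pwDl.
apply: cvgD; first exact: cvg_cst.
move: hc; rewrite (_ : (fun n => _ + _) = cfrac_upto R g) //.
by apply/funext => n; rewrite add0r.
Qed.

Definition cf_tail a n := cf_value (shift n a).

Lemma cf_tail_itv a n : pos_quotients a -> 0 <= cf_tail a n <= 1.
Proof. by move=> ha; case: (cf_value_itv (pos_quotients_shift n ha)). Qed.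

Lemma cf_tailS a n : pos_quotients a ->
  cf_tail a n = ((a n.+1)%:R + cf_tail a n.+1)^-1.
Proof.
move=> ha; have hn := pos_quotients_shift n ha.
have hS := pos_quotients_shift n.+1 ha.
have [[_ cv] _] := cf_value_itv hn.
have [cvS /andP[S0 _]] := cf_value_itv hS.
have [_ cv'] := @infinite_expansion_cons (shift n a) _ _ hn S0
  (fun i => etrans (f_equal a (addnS n i.+1)) erefl) cvS.
rewrite {2}/shift addn1 in cv'.
exact: cvg_unique cv cv'.
Qed.

Lemma cf_value_tail a n : pos_quotients a ->
  cf_value a = cfrac_with a n (cf_tail a n).
Proof.
move=> ha; elim: n => [//|n IH].
by rewrite cfrac_with_rcons -cf_tailS.
Qed.

Lemma cf_value_error a n : pos_quotients a ->
  cf_value a - cfrac_upto R a n =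
  (-1) ^+ n / ((den a n)%:R * ((den a n.+1)%:R + cf_tail a n.+1 * (den a n)%:R)).
Proof.
move=> ha; have /andP[t0 _] := cf_tail_itv n ha.
have /andP[t'0 _] := cf_tail_itv n.+1 ha.
rewrite {1}(cf_value_tail n ha) cfrac_with_error// cf_tailS// denSR.
have h' := den_gt0R n ha.
have a1 : 0 < (a n.+1)%:R :> R by rewrite ltr0n ha.
have p : 0 <= (den_prev a n)%:R :> R by [].
have u : 0 < (a n.+1)%:R + cf_tail a n.+1 by rewrite ltr_pwDl.
congr (_ * _); field; rewrite !gt_eqF//=.
have := mulr_gt0 u h'; lra.
Qed.

Lemma rational_nat n : rational (n%:R : R).
Proof. by exists n%:R; rewrite // ratr_nat. Qed.

Lemma rationalD x y : rational x -> rational y -> rational (x + y).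
Proof. by move=> [p _ <-] [q _ <-]; exists (p + q); rewrite // rmorphD. Qed.

Lemma rationalV x : rational x -> rational x^-1.
Proof. by move=> [p _ <-]; exists p^-1; rewrite // fmorphV. Qed.

Lemma rational_cfrac_with a n t : rational t -> rational (cfrac_with a n t).
Proof.
elim: n a => //= n IH a ht.
by apply/rationalV/rationalD; [exact: rational_nat|exact: IH].
Qed.

Lemma irrationalB x y : irrational x -> rational y -> irrational (x - y).
Proof.
move=> hx hy hxy; apply: hx; rewrite -(subrK y x); exact: rationalD.
Qed.

Lemma irrationalV x : irrational x -> irrational x^-1.
Proof. by move=> hx hv; apply: hx; rewrite -(invrK x); exact: rationalV. Qed.

(** On an irrational point of (0,1) the partial quotients are read off by
    iterating the Gauss map, which never leaves the irrational points. *)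
Definition gauss_map x : R := x^-1 - (Num.truncn x^-1)%:R.

Lemma gauss_map_itv x : irrational x -> 0 < x < 1 ->
  irrational (gauss_map x) /\ 0 < gauss_map x < 1.
Proof.
move=> hx /andP[x0 x1].
have hg : irrational (gauss_map x).
  by apply: irrationalB (irrationalV hx) _; exact: rational_nat.
split=> //; rewrite lt_neqAle eq_sym.
have /truncn_itv/andP[h1 h2] : 0 <= x^-1 by rewrite invr_ge0 ltW.
rewrite -natr1 in h2.
have -> : gauss_map x != 0.
  by apply/eqP => g0; apply: hg; rewrite g0; exact: (rational_nat 0).
rewrite /gauss_map; lra.
Qed.

Definition gauss_quotient x i : nat := Num.truncn (iter i.-1 gauss_map x)^-1.

Lemma gauss_expansion x : irrational x -> 0 < x < 1 ->
  infinite_expansion x 0 (gauss_quotient x).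
Proof.
move=> hx x01.
have hi n : irrational (iter n gauss_map x) /\ 0 < iter n gauss_map x < 1.
  by elim: n => //= n [IH1 IH2]; exact: gauss_map_itv.
apply: (@infinite_expansion_of_tails _ (fun n => iter n gauss_map x)).
- move=> [//|i] _; rewrite /gauss_quotient /=.
  case: (hi i) => _ /andP[i0 i1].
  by rewrite truncn_gt0 invf_ge1// ltW.
- by move=> n; case: (hi n) => _; lra.
- elim=> [//|n IH]; rewrite cfrac_with_rcons {1}IH; congr cfrac_with.
  by rewrite /gauss_quotient /= {3}/gauss_map addrC subrK invrK.
Qed.

(** Only the quotient following the prepended ones is recorded: it is the one
    that the algorithm reads. *)
Lemma infinite_expansion_prepend b n g x : pos_quotients b -> 0 <= x <= 1 ->
  infinite_expansion x 0 g ->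
  exists2 a, infinite_expansion (cfrac_with b n x) 0 a & a n.+1 = g 1%N.
Proof.
move=> hb hx hg; elim: n b hb => [|n IH] b hb; first by exists g.
have hb1 := pos_quotients_shift 1 hb.
have [a ha han] := IH _ hb1.
exists (fun i => if i is j.+2 then a j.+1 else b 1%N) => //=.
apply: (@infinite_expansion_cons (fun i => if i is j.+2 then a j.+1 else b 1%N) a) => //.
- by case=> [//|[|j]] _; [exact: hb|case: ha => + _; exact].
- by have /andP[] := cfrac_with_itv n hb1 hx.
Qed.

(** The points whose expansion begins with b_1, ..., b_n, k form an interval, and
    measured from the n-th convergent, with the sign of (-1)^n, its end points
    are the two bounds. For irrational x inside, solving the Moebius formula
    for the tail gives y with k < y < k + 1 and x = [0; b_1, ..., b_n + 1/y];
    the expansion of 1/y, whose first quotient is k, then completes that of x. *)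
Lemma partial_quotient_of_bounds b n k x : pos_quotients b -> (0 < k)%N ->
  irrational x ->
  ((den b n)%:R * ((den b n)%:R * (k%:R + 1) + (den_prev b n)%:R))^-1
    < (-1) ^+ n * (x - cfrac_upto R b n)
    < ((den b n)%:R * ((den b n)%:R * k%:R + (den_prev b n)%:R))^-1 ->
  partial_quotient x n.+1 k.
Proof.
move=> hb k0 hx.
set s := _ * (x - _); set q := (den b n)%:R; set p := (den_prev b n)%:R.
have q0 : 0 < q by exact: den_gt0R.
have p0 : 0 <= p by exact: ler0n.
have k1 : 1 <= k%:R :> R by rewrite ler1n.
have qk : 0 < q * k%:R by rewrite mulr_gt0//; lra.
have d0 : 0 < q * (q * k%:R + p) by rewrite mulr_gt0//; lra.
have d1 : 0 < q * (q * (k%:R + 1) + p) by rewrite mulr_gt0//; lra.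
move=> /andP[h1 h2].
have s0 : 0 < s by apply: lt_trans h1; rewrite invr_gt0.
have sq0 : 0 < s * q by rewrite mulr_gt0.
(* y solves s = 1 / (q * (q * y + p)), the error formula at the tail 1 / y. *)
pose y := ((s * q)^-1 - p) / q.
have sqE : (s * q)^-1 = q * y + p by rewrite /y; field; rewrite !gt_eqF.
have y1 : y < k%:R + 1.
  rewrite -(ltr_pM2l q0) -(ltrD2r p) -sqE -[ltRHS]invrK ltf_pV2 ?posrE ?invr_gt0//; last by lra.
  by rewrite -(ltr_pM2r (_ : 0 < q^-1)) ?invr_gt0// mulfK ?gt_eqF// -invfM mulrC.
have y0 : k%:R < y.
  rewrite -(ltr_pM2l q0) -(ltrD2r p) -sqE -[ltLHS]invrK ltf_pV2 ?posrE ?invr_gt0//; last by lra.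
  by rewrite -(ltr_pM2r (_ : 0 < q^-1)) ?invr_gt0// mulfK ?gt_eqF// -invfM mulrC.
have yp : 0 < y by lra.
have xE : x = cfrac_with b n y^-1.
  apply: (addIr (- cfrac_upto R b n)); rewrite cfrac_with_error ?invr_ge0 ?ltW//.
  rewrite -[LHS](signrMK n) -/s; congr (_ * _).
  rewrite -/q -/p; have -> : q * (q + y^-1 * p) = q * (q * y + p) / y.
    by field; rewrite gt_eqF.
  by rewrite -sqE; field; rewrite !gt_eqF.
have hy : irrational y^-1.
  by move=> r; apply: hx; rewrite xE; exact: rational_cfrac_with.
have y01 : 0 < y^-1 < 1 by rewrite invr_gt0 invf_lt1//; lra.
have [] := @infinite_expansion_prepend b n _ y^-1 hb _ (gauss_expansion hy y01).
  by case/andP: y01 => *; rewrite !ltW.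
rewrite -xE => a ha han; right; exists 0, a; split => //; split => //.
rewrite han /gauss_quotient /= invrK; apply/truncn_def.
by rewrite -natr1 ltW.
Qed.

End ContinuedFractions.

(** * Sums of two continued fractions *)

Section Criterion.
Context {R : realType}.

(** The four inequalities place the errors of the convergents in the intervals
    that partial_quotient_of_bounds asks for. Write the errors of beta_n,
    gamma_n and beta_(n+1) as e, E and e', the signs being +, + and - up to
    (-1)^n. Consecutive convergents of beta are at distance e + e'; so
    1/(q * q1) < e + E says e' < E, which the last hypothesis implies, and
    E - e' < 1/(Q * Q1) holds because E <= 1/(Q * Q1). The other two
    inequalities are the hypotheses, after reduction to a common
    denominator. *)
Lemma error_bounds (q q1 q2 Q Q1 t t2 b2 T : R) :
  0 < q -> q < q1 -> 0 < Q -> 0 < Q1 -> 1 <= b2 -> 0 <= t2 -> 0 <= T ->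
  q2 = b2 * q1 + q -> t = (b2 + t2)^-1 ->
  (q1 - q) * (q1 + t * q) < (1 + t) * (Q * (Q1 + T * Q)) ->
  (Q1 + Q) * (Q1 + T * Q) < (1 - T) * (q1 * (q2 + t2 * q1)) ->
  (q * q1)^-1 < (q * (q1 + t * q))^-1 + (Q * (Q1 + T * Q))^-1
    < (q * (q1 - q))^-1 /\
  (Q * (Q1 + Q))^-1 < (Q * (Q1 + T * Q))^-1 - (q1 * (q2 + t2 * q1))^-1
    < (Q * Q1)^-1.
Proof.
move=> q0 qq1 Q0 Q10 b21 t20 T0 q2E tE hA hB.
have b0 : 0 < b2 + t2 by lra.
have t0 : 0 < t by rewrite tE invr_gt0.
have q10 : 0 < q1 by lra.
have tq : 0 < t * q by rewrite mulr_gt0.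
have TQ : 0 <= T * Q by rewrite mulr_ge0// ltW.
have D0 : 0 < (q1 - q) * (q1 + t * q) by rewrite mulr_gt0; lra.
have E0 : 0 < Q * (Q1 + T * Q) by rewrite mulr_gt0//; lra.
have q2t : q2 + t2 * q1 = (q1 + t * q) / t.
  by rewrite q2E tE; field; rewrite gt_eqF.
have q2t0 : 0 < q2 + t2 * q1 by rewrite q2t divr_gt0; lra.
have F0 : 0 < q1 * (q2 + t2 * q1) by rewrite mulr_gt0.
have G0 : 0 < (Q1 + Q) * (Q1 + T * Q) by rewrite mulr_gt0; lra.
have gA : (Q * (Q1 + T * Q))^-1 < (1 + t) / ((q1 - q) * (q1 + t * q)).
  by rewrite ltr_pdivlMr// mulrC ltr_pdivrMr.
have gB : (q1 * (q2 + t2 * q1))^-1 < (1 - T) / ((Q1 + Q) * (Q1 + T * Q)).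
  by rewrite ltr_pdivlMr// mulrC ltr_pdivrMr.
have iA : (q * (q1 - q))^-1 - (q * (q1 + t * q))^-1 =
    (1 + t) / ((q1 - q) * (q1 + t * q)).
  by field; rewrite !gt_eqF//; lra.
have iB : (Q * (Q1 + T * Q))^-1 - (Q * (Q1 + Q))^-1 =
    (1 - T) / ((Q1 + Q) * (Q1 + T * Q)).
  by field; rewrite !gt_eqF//; lra.
have iC : (q * q1)^-1 - (q * (q1 + t * q))^-1 = (q1 * (q2 + t2 * q1))^-1.
  by rewrite q2t; field; rewrite !gt_eqF//; lra.
have F1 : 0 < (q1 * (q2 + t2 * q1))^-1 by rewrite invr_gt0.
have iD : (Q * (Q1 + T * Q))^-1 <= (Q * Q1)^-1.
  by rewrite lef_pV2 ?posrE ?(mulr_gt0 Q0 Q10)// ler_pM2l//; lra.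
have iE : 0 < (Q * (Q1 + Q))^-1 by rewrite invr_gt0 mulr_gt0//; lra.
by split; apply/andP; split; lra.
Qed.

(** If beta + gamma had denominator M, its difference to beta_n + gamma_n would
    be a multiple of 1/(M q_n Q_n). It is not zero because both errors have the
    sign of (-1)^n, and it is smaller than that as soon as the hypothesis
    applies. *)
Lemma irrational_sum_cf b c : pos_quotients b -> pos_quotients c ->
  (forall M : nat, exists n, M%:R *
    ((den c n)%:R / (den b n.+1)%:R + (den b n)%:R / (den c n.+1)%:R) < 1 :> R) ->
  irrational (cf_value b + cf_value c : R).
Proof.
move=> hb hc small /rationalP xE.
have {xE}[p [M M0 xE]] : exists p : int, exists2 M : nat, (0 < M)%N &
    cf_value b + cf_value c = p%:~R / M%:R :> R.
  (* The representation allows M = 0, where p / 0 = 0 = 0 / 1. *)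
  case: xE => p [[|M] xE]; last by exists p, M.+1.
  by exists 0, 1%N; rewrite // xE invr0 mulr0 mul0r.
have [n] := small M; apply/negP; rewrite -leNgt.
have q0 := @den_gt0R R b n hb; have q1 := @den_gt0R R b n.+1 hb.
have Q0 := @den_gt0R R c n hc; have Q1 := @den_gt0R R c n.+1 hc.
have /andP[t0 _] := @cf_tail_itv R b n.+1 hb.
have /andP[T0 _] := @cf_tail_itv R c n.+1 hc.
have eb := @cf_value_error R b n hb; have ec := @cf_value_error R c n hc.
have tq : 0 <= cf_tail b n.+1 * (den b n)%:R :> R by apply: mulr_ge0.
have TQ : 0 <= cf_tail c n.+1 * (den c n)%:R :> R by apply: mulr_ge0.
set D : R := (den b n)%:R * ((den b n.+1)%:R + cf_tail b n.+1 * (den b n)%:R) in eb.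
set E : R := (den c n)%:R * ((den c n.+1)%:R + cf_tail c n.+1 * (den c n)%:R) in ec.
have D0 : 0 < D by rewrite mulr_gt0// ltr_pwDl.
have E0 : 0 < E by rewrite mulr_gt0// ltr_pwDl.
have [zb zbE] : exists z : int, cfrac_upto R b n * (den b n)%:R = z%:~R.
  exists (numer b n)%:Z; rewrite cfrac_upto_with cfrac_with_mobius// !mul0r !addr0.
  by rewrite divfK ?gt_eqF.
have [zc zcE] : exists z : int, cfrac_upto R c n * (den c n)%:R = z%:~R.
  exists (numer c n)%:Z; rewrite cfrac_upto_with cfrac_with_mobius// !mul0r !addr0.
  by rewrite divfK ?gt_eqF.
pose z : int := p * ((den b n)%:Z * (den c n)%:Z) - M%:Z * (zb * (den c n)%:Z + zc * (den b n)%:Z).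
have zE : z%:~R = (-1) ^+ n * (M%:R * ((den b n)%:R * (den c n)%:R) * (D^-1 + E^-1)) :> R.
  have -> : z%:~R = M%:R * ((den b n)%:R * (den c n)%:R) *
     ((cf_value b - cfrac_upto R b n) + (cf_value c - cfrac_upto R c n)) :> R.
    rewrite /z !(rmorphB, rmorphM, rmorphD)/= -zbE -zcE -!pmulrn.
    have -> : p%:~R = M%:R * (cf_value b + cf_value c) :> R.
      by rewrite xE mulrC divfK// pnatr_eq0 -lt0n.
    ring.
  by rewrite eb ec; ring.
have z1 : 1 <= `|z%:~R : R|.
  rewrite -intr_norm -[1]/(1%:~R) ler_int.
  rewrite -gtz0_ge1 normr_gt0 -(intr_eq0 R) zE mulf_neq0 ?signr_eq0//.
  have MqQ : 0 < M%:R * ((den b n)%:R * (den c n)%:R) :> R.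
    by rewrite mulr_gt0 ?ltr0n// mulr_gt0.
  by rewrite gt_eqF// mulr_gt0// addr_gt0 ?invr_gt0.
apply: (le_trans z1); rewrite zE normrMsign ger0_norm; last first.
  by apply: mulr_ge0; [apply: mulr_ge0 => //; apply: mulr_ge0|rewrite addr_ge0 ?invr_ge0 ?ltW].
rewrite -mulrA; apply: ler_wpM2l => //; rewrite mulrDr; apply: lerD.
- rewrite /D invfM mulrA (mulrC (den b n)%:R) mulfK ?gt_eqF// ler_pM2l//.
  by rewrite lef_pV2 ?posrE ?ltr_pwDl// lerDl.
- rewrite /E invfM mulrA mulfK ?gt_eqF// ler_pM2l//.
  by rewrite lef_pV2 ?posrE ?ltr_pwDl// lerDl.
Qed.

Variables b c : nat -> nat.

Local Notation q n := ((den b n)%:R : R).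
Local Notation Q n := ((den c n)%:R : R).
Local Notation t n := (cf_tail b n : R).
Local Notation T n := (cf_tail c n : R).

(** The algorithm applied to beta + gamma retrieves b and c when two conditions
    hold for every n: the error of gamma_n is small enough to lower the next
    quotient of beta by exactly one, and the error of beta_(n+1), of opposite
    sign, is too small to alter the next quotient of gamma. *)
Lemma shulga_sequences_of_bounds :
  (forall i, (0 < i)%N -> (1 < b i)%N) -> pos_quotients c ->
  irrational (cf_value b + cf_value c : R) ->
  (forall n, (q n.+1 - q n) * (q n.+1 + t n.+1 * q n)
     < (1 + t n.+1) * (Q n * (Q n.+1 + T n.+1 * Q n))) ->
  (forall n, (Q n.+1 + Q n) * (Q n.+1 + T n.+1 * Q n)
     < (1 - T n.+1) * (q n.+1 * (q n.+2 + t n.+2 * q n.+1))) ->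
  shulga_sequences (cf_value b + cf_value c : R) b c.
Proof.
move=> hb1 hc irr HA HB n.
have hb : pos_quotients b by move=> i /hb1; apply: ltn_trans.
have rat a m : rational (cfrac_upto R a m).
  by rewrite cfrac_upto_with; apply: rational_cfrac_with; exact: (rational_nat 0).
have dq : q n < q n.+1.
  rewrite denSR; have : 2 <= (b n.+1)%:R :> R by rewrite ler_nat hb1.
  have := @den_gt0R R b n hb.
  have : 0 <= (den_prev b n)%:R :> R by [].
  nra.
have [] := error_bounds (@den_gt0R R b n hb) dq (@den_gt0R R c n hc)
  (@den_gt0R R c n.+1 hc) _ _ _ (@denSR R b n.+1) (@cf_tailS R b n.+1 hb)
  (HA n) (HB n).
- by rewrite ler1n hb.
- by have /andP[] := @cf_tail_itv R b n.+2 hb.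
- by have /andP[] := @cf_tail_itv R c n.+1 hc.
have eb := @cf_value_error R b n hb; have ec := @cf_value_error R c n hc.
have eb1 := @cf_value_error R b n.+1 hb.
have bk : ((b n.+1).-1)%:R = (b n.+1)%:R - 1 :> R.
  by rewrite -[in RHS](prednK (hb n.+1 isT)) -natr1 addrK.
have sK (y : R) : (-1) ^+ n * ((-1) ^+ n * y) = y by exact: signrMK.
move=> bA bB; split.
- by move=> e; apply: irr; rewrite e; exact: rationalD.
- exists (b n.+1).-1; last by rewrite prednK// hb.
  apply: (@partial_quotient_of_bounds R b) => //.
  + by have := hb1 n.+1 isT; case: (b n.+1) => [|[]].
  + exact: irrationalB.
  + have -> : (den b n)%:R * ((den b n)%:R * ((b n.+1).-1%:R + 1)
                + (den_prev b n)%:R) = q n * q n.+1.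
      by rewrite bk denSR; ring.
    have -> : (den b n)%:R * ((den b n)%:R * (b n.+1).-1%:R
                + (den_prev b n)%:R) = q n * (q n.+1 - q n).
      by rewrite bk denSR; ring.
    have -> : cf_value b + cf_value c - cfrac_upto R c n - cfrac_upto R b n =
        (cf_value b - cfrac_upto R b n) + (cf_value c - cfrac_upto R c n) by ring.
    by rewrite eb ec -mulrDr sK.
- apply: (@partial_quotient_of_bounds R c) => //.
  + exact: hc.
  + exact: irrationalB.
  + have -> : (den c n)%:R * ((den c n)%:R * ((c n.+1)%:R + 1)
                + (den_prev c n)%:R) = Q n * (Q n.+1 + Q n).
      by rewrite denSR; ring.
    have -> : (den c n)%:R * ((den c n)%:R * (c n.+1)%:R
                + (den_prev c n)%:R) = Q n * Q n.+1.
      by rewrite denSR; ring.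
    have -> : cf_value b + cf_value c - cfrac_upto R b n.+1 - cfrac_upto R c n =
        (cf_value c - cfrac_upto R c n) + (cf_value b - cfrac_upto R b n.+1) by ring.
    by rewrite ec eb1 exprS mulN1r mulNr -mulrBr sK.
Qed.

End Criterion.

(** * The two sequences *)

(** The rule keeping the squared ratio r = (Q/q)^2 of the two denominators just
    below the next quotient of beta, b - 3 <= r < b - 2. Passing to the next
    denominators adds about 2d to r when c = b + d, so the choice between 3
    and 2 steers r between 4n and 5n. The first two pairs do not follow the
    rule: they bring r into that range. *)
Definition next_quotients (n q Q : nat) : nat * nat :=
  match n with
  | 0 => (2, 4)
  | 1 => (6, 9)
  | _ => let m := Q ^ 2 %/ q ^ 2 in
         (m + 3, m + 3 + (if m <= 4 * n then 3 else 2))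
  end%N.

(** The rule needs the denominators produced by the quotients chosen so far, so
    the recursion carries, for each of the two fractions, its last two
    denominators. *)
Fixpoint denominators (n : nat) : (nat * nat) * (nat * nat) :=
  if n is n'.+1 then
    let: ((q', q), (Q', Q)) := denominators n' in
    let: (x, y) := next_quotients n' q Q in
    ((q, (x * q + q')%N), (Q, (y * Q + Q')%N))
  else ((0, 1), (0, 1))%N.

Definition quotb (i : nat) : nat :=
  (next_quotients i.-1 (denominators i.-1).1.2 (denominators i.-1).2.2).1.

Definition quotc (i : nat) : nat :=
  (next_quotients i.-1 (denominators i.-1).1.2 (denominators i.-1).2.2).2.

Lemma denominatorsE n :
  denominators n = ((den_prev quotb n, den quotb n), (den_prev quotc n, den quotc n)).
Proof.
elim: n => // n; rewrite !denS !den_prevS /quotb /quotc [n.+1.-1]/=.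
rewrite [denominators n.+1]/=.
case: (denominators n) => [[q' q] [Q' Q]] [-> -> -> ->] /=.
by case: next_quotients.
Qed.

Lemma quotbcE n : (quotb n.+1, quotc n.+1) = next_quotients n (den quotb n) (den quotc n).
Proof. by rewrite /quotb /quotc /= denominatorsE -surjective_pairing. Qed.

Lemma quotbc_step n : (2 <= n)%N ->
  let m := ((den quotc n) ^ 2 %/ (den quotb n) ^ 2)%N in
  quotb n.+1 = (m + 3)%N /\
  quotc n.+1 = (m + 3 + (if m <= 4 * n then 3 else 2))%N.
Proof. by move=> n2; have := quotbcE n; case: n n2 => [|[|n]] // _ [-> ->]. Qed.

Lemma quotb_gt1 i : (0 < i)%N -> (1 < quotb i)%N.
Proof.
case: i => [//|[//|[//|i]]] _; by have [-> _] := @quotbc_step i.+2 isT; rewrite addn3.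
Qed.

Lemma quotb_pos : pos_quotients quotb.
Proof. by move=> i /quotb_gt1; apply: ltn_trans. Qed.

Lemma quotb_lt_quotc i : (0 < i)%N -> (quotb i < quotc i)%N.
Proof.
case: i => [//|[//|[//|i]]] _; have [-> ->] := @quotbc_step i.+2 isT.
by case: ifP => _; rewrite -[ltnLHS]addn0 ltn_add2l.
Qed.

Lemma quotc_pos : pos_quotients quotc.
Proof. by move=> i i0; apply: leq_ltn_trans (quotb_lt_quotc i0). Qed.

Lemma den_initial : [/\ den quotb 1 = 2, den quotb 2 = 13, den quotc 1 = 4
  & den quotc 2 = 37]%N.
Proof. by []. Qed.

Lemma quotbc3 : quotb 3 = 11%N /\ quotc 3 = 14%N.
Proof.
have [-> ->] := @quotbc_step 2 isT.
by have [_ -> _ ->] := den_initial.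
Qed.

(** Up to smaller terms the ratio of consecutive denominators is the inverse of
    the last quotient, and that quotient is larger for gamma by at least
    one, which absorbs the smaller terms. *)
Lemma den_prev_cross n :
  (den_prev quotc n * den quotb n <= den_prev quotb n * den quotc n)%N.
Proof.
case: n => // n; rewrite !den_prevS !denS.
have := quotb_lt_quotc (ltn0Sn n).
have hb : (den_prev quotb n <= den quotb n)%N.
  case: n => // n; rewrite den_prevS denS.
  by have := quotb_pos (ltn0Sn n); case: (quotb n.+1) => // k _; rewrite mulSn -addnA leq_addr.
move: hb; move: (den quotb n) (den quotc n) (den_prev quotb n) (den_prev quotc n) => q Q q' Q'.
move: (quotb n.+1) (quotc n.+1) => x y hq xy.
have := leq_mul (leqnn Q) hq; have := leq_mul xy (leqnn (q * Q)); nia.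
Qed.

(** * Estimates for the squared ratio of the denominators *)

Section RatioEstimates.
Context {R : realType}.

(** One step multiplies Q/q by (c + S)/(b + s), where s and S are the ratios of
    consecutive denominators. Since 0 <= S <= s and b <= c, this factor lies
    between c/(b + s) and c/b. *)
Lemma ratio_step (q0 q1 Q0 Q1 b c s r r1 : R) : 0 < q0 -> 0 < Q0 ->
  0 < b -> b <= c -> 0 <= q1 -> 0 <= Q1 -> Q1 * q0 <= q1 * Q0 ->
  s = q1 / q0 -> r = (Q0 / q0) ^+ 2 ->
  r1 = ((c * Q0 + Q1) / (b * q0 + q1)) ^+ 2 ->
  r1 * b ^+ 2 <= r * c ^+ 2 /\ r * c ^+ 2 <= r1 * (b + s) ^+ 2.
Proof.
move=> q0_gt0 Q0_gt0 b0 bc q1_ge0 Q1_ge0 cross -> -> ->.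
have c0 : 0 < c by lra.
have d0 : 0 < b * q0 + q1 by rewrite ltr_pwDl// mulr_gt0.
have n0 : 0 <= c * Q0 + Q1 by rewrite addr_ge0// mulr_ge0// ltW.
have [b0' c0' q0' Q0' d0'] : [/\ 0 <= b, 0 <= c, 0 <= q0, 0 <= Q0
    & 0 <= b * q0 + q1] by split; apply: ltW.
rewrite -!exprMn; split; apply: lerXn2r;
  rewrite ?nnegrE ?(mulr_ge0, invr_ge0, addr_ge0)//.
- rewrite -subr_ge0.
  have -> : Q0 / q0 * c - (c * Q0 + Q1) / (b * q0 + q1) * b =
      (c * (q1 * Q0) - b * (Q1 * q0)) / (q0 * (b * q0 + q1)).
    by field; rewrite !gt_eqF.
  apply: divr_ge0; rewrite ?mulr_ge0// subr_ge0.
  by apply: ler_pM; rewrite ?mulr_ge0.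
- have -> : (c * Q0 + Q1) / (b * q0 + q1) * (b + q1 / q0) =
      Q0 / q0 * c + Q1 / q0.
    by field; rewrite !gt_eqF.
  by rewrite lerDl divr_ge0.
Qed.

(** To first order r1 is r + 6, and r lies between b - 3 and b - 2; the
    correction terms take less than 2 away and add nothing. *)
Lemma ratio_window3 (r r1 b s : R) : 10 <= b -> b - 3 <= r < b - 2 ->
  0 <= s <= 6^-1 ->
  r1 * b ^+ 2 <= r * (b + 3) ^+ 2 -> r * (b + 3) ^+ 2 <= r1 * (b + s) ^+ 2 ->
  b + 1 <= r1 < b + 4.
Proof.
move=> b10 /andP[r0 rb] /andP[s0 s6] h1 h2.
have b2 : 0 < b ^+ 2 by rewrite exprn_gt0//; lra.
have bs2 : 0 < (b + s) ^+ 2 by rewrite exprn_gt0//; lra.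
have b32 : 0 < (b + 3) ^+ 2 by rewrite exprn_gt0//; lra.
apply/andP; split.
- rewrite -(ler_pM2r bs2); apply: le_trans h2.
  apply: (@le_trans _ _ ((b - 3) * (b + 3) ^+ 2)); last by rewrite ler_pM2r.
  have : (b + s) ^+ 2 <= (b + 6^-1) ^+ 2 by apply: lerXn2r; rewrite ?nnegrE; lra.
  move=> /(ler_wpM2l (_ : 0 <= b + 1)) h; apply: le_trans (h _) _; first lra.
  rewrite !expr2; nra.
- rewrite -(ltr_pM2r b2); apply: le_lt_trans h1 _.
  apply: (@lt_trans _ _ ((b - 2) * (b + 3) ^+ 2)); first by rewrite ltr_pM2r.
  rewrite !expr2; nra.
Qed.

(** As in ratio_window3, with an increase of about 4 to first order. *)
Lemma ratio_window2 (r r1 b s : R) : 12 <= b -> b - 3 <= r < b - 2 ->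
  0 <= s <= 6^-1 ->
  r1 * b ^+ 2 <= r * (b + 2) ^+ 2 -> r * (b + 2) ^+ 2 <= r1 * (b + s) ^+ 2 ->
  b - 1 <= r1 < b + 2.
Proof.
move=> b10 /andP[r0 rb] /andP[s0 s6] h1 h2.
have b2 : 0 < b ^+ 2 by rewrite exprn_gt0//; lra.
have bs2 : 0 < (b + s) ^+ 2 by rewrite exprn_gt0//; lra.
have b32 : 0 < (b + 2) ^+ 2 by rewrite exprn_gt0//; lra.
apply/andP; split.
- rewrite -(ler_pM2r bs2); apply: le_trans h2.
  apply: (@le_trans _ _ ((b - 3) * (b + 2) ^+ 2)); last by rewrite ler_pM2r.
  have : (b + s) ^+ 2 <= (b + 6^-1) ^+ 2 by apply: lerXn2r; rewrite ?nnegrE; lra.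
  move=> /(ler_wpM2l (_ : 0 <= b - 1)) h; apply: le_trans (h _) _; first lra.
  rewrite !expr2; nra.
- rewrite -(ltr_pM2r b2); apply: le_lt_trans h1 _.
  apply: (@lt_trans _ _ ((b - 2) * (b + 2) ^+ 2)); first by rewrite ltr_pM2r.
  rewrite !expr2; nra.
Qed.

(** The two sides of the condition on the quotients of beta, divided by q_n^2,
    after r has been replaced by its lower bound b - 3. Comparing
    b^2 - b with b^2 leaves room of order b; the bound on t is for
    the smallest b. *)
Lemma quotb_margin3 (b s t : R) : 10 <= b -> 0 <= s <= 6^-1 -> s * b <= 2 ->
  0 <= t -> 1 <= t * (b + 8) ->
  (b + s - 1) * (b + s + t) < (1 + t) * ((b + 3) * (b - 3)).
Proof. by move=> b10 /andP[s0 s6] sb t0 t1; nra. Qed.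

(** Here b^2 - b stands on both sides and the constant terms favour the left
    side; only the contribution t * b^2, about b, of the tail on the right
    decides. Hence the lower bounds on b and t. *)
Lemma quotb_margin2 (b s t : R) : 16 <= b -> 0 <= s <= 6^-1 -> 10 * (s * b) <= 17 ->
  0 <= t -> 1 <= t * (b + 6) ->
  (b + s - 1) * (b + s + t) < (1 + t) * ((b + 2) * (b - 3)).
Proof. by move=> b10 /andP[s0 s6] sb t0 t1; nra. Qed.

(** The condition on the quotients of gamma, divided by q^2. Since r is at most
    about c, the left side is about r + 1 + sg, while the right side is
    about r + 2 + s - T * (r + 2) and T * (r + 4) <= 1. What remains to
    compare is sg + T * (1 + sg)^2 with s + 2 * T - T * s. *)
Lemma quotc_margin (c r s sg T : R) : 0 <= r -> r <= c + 1 -> 0 <= sg -> sg <= s ->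
  s <= 6^-1 -> sg * c <= 1 -> 0 < T -> T * (r + 4) <= 1 ->
  r * ((1 + sg) * (1 + T * sg)) < (1 - T) * (r + 2 + s).
Proof.
move=> r0 rc sg0 sgs s6 sgc T0 Tr.
have h1 : r * sg <= 1 + sg by nra.
have h2 : r * sg * (T * (1 + sg)) <= (1 + sg) * (T * (1 + sg)).
  by rewrite ler_wpM2r// mulr_ge0//; lra.
have h3 : (1 + sg) ^+ 2 <= (1 + 6^-1) ^+ 2 by apply: lerXn2r; rewrite ?nnegrE; lra.
have h4 : T * (1 + sg) ^+ 2 <= T * (1 + 6^-1) ^+ 2 by rewrite ler_pM2l.
have h5 : T * s <= T * 6^-1 by rewrite ler_pM2l.
rewrite !expr2 in h4; lra.
Qed.

End RatioEstimates.

(** * Invariants of the two sequences *)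

Section Invariants.
Context {R : realType}.
Local Notation q n := ((den quotb n)%:R : R).
Local Notation Q n := ((den quotc n)%:R : R).
Local Notation t n := (cf_tail quotb n : R).
Local Notation T n := (cf_tail quotc n : R).

Definition sq_ratio n : R := (Q n / q n) ^+ 2.
Definition den_ratio (a : nat -> nat) n : R := (den_prev a n)%:R / (den a n)%:R.

Lemma den_ratio_ge0 a n : 0 <= den_ratio a n.
Proof. exact: divr_ge0. Qed.

Lemma den_ratio_bound a n : pos_quotients a -> den_ratio a n.+1 * (a n.+1)%:R <= 1.
Proof.
move=> ha; rewrite /den_ratio mulrAC ler_pdivrMr ?den_gt0R// mul1r den_prevS denSR.
by rewrite mulrC lerDl.
Qed.

Lemma den_ratio_cross n : den_ratio quotc n <= den_ratio quotb n.
Proof.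
rewrite /den_ratio ler_pdivrMr ?(den_gt0R _ quotc_pos)// mulrAC.
by rewrite ler_pdivlMr ?(den_gt0R _ quotb_pos)// -!natrM ler_nat den_prev_cross.
Qed.

Lemma quotbc_floor n : (2 <= n)%N -> exists2 m : nat,
  m%:R <= sq_ratio n < m%:R + 1 &
  quotb n.+1 = (m + 3)%N /\ quotc n.+1 = (m + 3 + (if m <= 4 * n then 3 else 2))%N.
Proof.
move=> n2; have := quotbc_step n2; set m := (_ %/ _)%N => /= hm.
exists m => //; rewrite natr1 /sq_ratio expr_div_n -!natrX.
have d0 : (0 < den quotb n ^ 2)%N by rewrite expn_gt0 den_gt0//; exact: quotb_pos.
rewrite ler_pdivlMr ?ltr0n// ltr_pdivrMr ?ltr0n// -!natrM ler_nat ltr_nat.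
by rewrite /m leq_trunc_div ltn_ceil.
Qed.

Lemma sq_ratio_step n :
  sq_ratio n.+1 * (quotb n.+1)%:R ^+ 2 <= sq_ratio n * (quotc n.+1)%:R ^+ 2 /\
  sq_ratio n * (quotc n.+1)%:R ^+ 2
    <= sq_ratio n.+1 * ((quotb n.+1)%:R + den_ratio quotb n) ^+ 2.
Proof.
apply: (@ratio_step R (q n) (den_prev quotb n)%:R (Q n) (den_prev quotc n)%:R) => //.
- exact: (den_gt0R _ quotb_pos).
- exact: (den_gt0R _ quotc_pos).
- by rewrite ltr0n quotb_pos.
- by rewrite ler_nat ltnW// quotb_lt_quotc.
- by rewrite -!natrM ler_nat den_prev_cross.
- by rewrite /sq_ratio !denSR.
Qed.

Lemma sq_ratio2 : sq_ratio 2 = (37 / 13) ^+ 2.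
Proof. by []. Qed.

(** The steering of sq_ratio: the increase of the ratio depends only on which
    of the two differences c - b was chosen. *)
Lemma sq_ratio_window n m : (2 <= n)%N -> (4 * n - 2 <= quotb n)%N ->
  m%:R <= sq_ratio n < m%:R + 1 ->
  quotb n.+1 = (m + 3)%N /\ quotc n.+1 = (m + 3 + (if m <= 4 * n then 3 else 2))%N ->
  (4 * n - 1 <= m)%N ->
  if (m <= 4 * n)%N then m%:R + 4 <= sq_ratio n.+1 < m%:R + 7
  else m%:R + 2 <= sq_ratio n.+1 < m%:R + 5.
Proof.
move=> n2 bn /andP[mr rm] [bE cE] mn.
have [h1 h2] := sq_ratio_step n.
move: h1 h2.
have s0 := den_ratio_ge0 quotb n.
have s6 : den_ratio quotb n <= 6^-1.
  have := @den_ratio_bound quotb n.-1 quotb_pos; rewrite prednK ?(ltnW n2)// => h.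
  have b6 : 6 <= (quotb n)%:R :> R by rewrite ler_nat; lia.
  rewrite -[6^-1]mul1r ler_pdivlMr//; apply: le_trans h; exact: ler_wpM2l.
have s06 : 0 <= den_ratio quotb n <= 6^-1 by rewrite s0 s6.
have rb : m%:R + 3 - 3 <= sq_ratio n < m%:R + 3 - 2 by apply/andP; split; lra.
rewrite bE cE; case: ifP => m4; rewrite !natrD.
  have b10 : 10 <= m%:R + 3 :> R by rewrite -natrD ler_nat; lia.
  move=> h1 h2; have /andP[w1 w2] := ratio_window3 b10 rb s06 h1 h2.
  by clear -w1 w2; apply/andP; split; lra.
have b12 : 12 <= m%:R + 3 :> R by rewrite -natrD ler_nat; lia.
move=> h1 h2; have /andP[w1 w2] := ratio_window2 b12 rb s06 h1 h2.
by clear -w1 w2; apply/andP; split; lra.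
Qed.

Lemma floor_itv_nat (r : R) n m : 4 * n%:R - 1 <= r -> r < 5 * n%:R ->
  m%:R <= r < m%:R + 1 ->
  [/\ 4 * n <= m.+1, m < 5 * n & 4 * n - 1 <= m]%N.
Proof.
move=> r1 r2 /andP[mr1 mr2].
have m1 : (4 * n <= m.+1)%N.
  by rewrite -ltnS -(ltr_nat R) -!natr1 natrM; clear -mr2 r1; lra.
have m2 : (m < 5 * n)%N by rewrite -(ltr_nat R) natrM; exact: le_lt_trans r2.
by split=> //; clear -m1; lia.
Qed.

(** Let m be the integer part of the ratio. If m <= 4n, the next value is at
    least m + 4 and less than m + 7 <= 4n + 7; otherwise it is at least
    m + 2 >= 4n + 3 and less than m + 5 <= 5n + 4. Hence the ratio stays
    between 4n - 1 and 5n, and the quotients, a bounded distance above it,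
    satisfy the required bounds. *)
Lemma sq_ratio_itv n : (2 <= n)%N ->
  [/\ (4 * n - 2 <= quotb n)%N, (quotc n < 5 * n)%N,
      4 * n%:R - 1 <= sq_ratio n, sq_ratio n < 5 * n%:R &
      sq_ratio n <= (quotc n)%:R + 1].
Proof.
elim: n => // n IH; rewrite leq_eqVlt => /orP[/eqP <-|n2].
  rewrite sq_ratio2; split => //; try by rewrite expr2; lra.
  by rewrite (_ : quotc 2 = 9%N)// expr2; lra.
have [bn _ r1 r2 _] := IH n2.
have [m mr mE] := quotbc_floor n2.
have [bE cE] := mE; have [m1 m2 m1'] := floor_itv_nat r1 r2 mr.
have := sq_ratio_window n2 bn mr mE m1'.
have nR : 2 <= n%:R :> R by rewrite ler_nat.
rewrite bE cE -natr1; case: ifP => hm /andP[w1 w2].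
  have m1R : 4 * n%:R <= m%:R + 1 :> R by rewrite natr1 -natrM ler_nat.
  have mR : m%:R <= 4 * n%:R :> R by rewrite -natrM ler_nat.
  rewrite !natrD; clear -n2 m1 m2 hm nR m1R mR w1 w2.
  split; [lia|lia| | |]; clear -nR m1R mR w1 w2; lra.
have m1R : 4 * n%:R + 1 <= m%:R :> R.
  by rewrite -natrM natr1 ler_nat ltnNge hm.
have mR : m%:R + 1 <= 5 * n%:R :> R by rewrite natr1 -natrM ler_nat.
rewrite !natrD; clear -n2 m1 m2 hm nR m1R mR w1 w2.
split; [lia|lia| | |]; clear -nR m1R mR w1 w2; lra.
Qed.

Lemma den_ratio_quotb n : (2 <= n)%N ->
  0 <= den_ratio quotb n <= 6^-1 /\ den_ratio quotb n * (4 * n%:R - 2) <= 1.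
Proof.
move=> n2; have s0 := den_ratio_ge0 quotb n.
have [bn _ _ _ _] := sq_ratio_itv n2.
have := @den_ratio_bound quotb n.-1 quotb_pos; rewrite prednK ?(ltnW n2)// => h.
have bR : 4 * n%:R - 2 <= (quotb n)%:R :> R.
  by rewrite -natrM lerBlDr -natrD ler_nat; clear -bn; lia.
have nR : 2 <= n%:R :> R by rewrite ler_nat.
split; last by apply: le_trans h; exact: ler_wpM2l.
rewrite s0 -[6^-1]mul1r ler_pdivlMr//; apply: le_trans h.
by apply: ler_wpM2l => //; clear -bR nR; lra.
Qed.

Lemma cf_tail_lower n : 1 <= cf_tail quotb n * ((quotb n.+1)%:R + 1) :> R.
Proof.
have /andP[t0 t1] := @cf_tail_itv R quotb n.+1 quotb_pos.
have b0 : 0 < (quotb n.+1)%:R :> R by rewrite ltr0n quotb_pos.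
rewrite (@cf_tailS R _ _ quotb_pos) ler_pdivlMl; last by rewrite ltr_pwDl.
by rewrite mulr1 lerD2l.
Qed.

Lemma cf_tail_upper n :
  0 < cf_tail quotc n :> R /\ cf_tail quotc n * (quotc n.+1)%:R <= 1 :> R.
Proof.
have /andP[t0 t1] := @cf_tail_itv R quotc n.+1 quotc_pos.
have c0 : 0 < (quotc n.+1)%:R :> R by rewrite ltr0n quotc_pos.
have u0 : 0 < (quotc n.+1)%:R + cf_tail quotc n.+1 :> R by rewrite ltr_pwDl.
rewrite (@cf_tailS R _ _ quotc_pos) invr_gt0; split=> //.
by rewrite ler_pdivrMl// mulr1 lerDl.
Qed.

(** The tail is bounded below by 1/(b' + 1), where b' is the next quotient,
    itself at most 3 above the next value of sq_ratio. *)
Lemma quotb_condition_ratio n : (2 <= n)%N ->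
  ((quotb n.+1)%:R + den_ratio quotb n - 1) *
    ((quotb n.+1)%:R + den_ratio quotb n + cf_tail quotb n.+1)
  < (1 + cf_tail quotb n.+1) * ((quotc n.+1)%:R * ((quotb n.+1)%:R - 3)) :> R.
Proof.
move=> n2; have [bn _ r1 r2 _] := sq_ratio_itv n2.
have [m mr mE] := quotbc_floor n2.
have [m1 m2 m1'] := floor_itv_nat r1 r2 mr.
have := sq_ratio_window n2 bn mr mE m1'.
have [s06 sn] := den_ratio_quotb n2; have /andP[s0 s6] := s06.
have /andP[t0 t1] := @cf_tail_itv R quotb n.+1 quotb_pos.
have tl := cf_tail_lower n.+1.
have [m' /andP[mr' _] [bE' _]] := quotbc_floor (leqW n2).
rewrite bE' in tl; have [bE cE] := mE.
have mR : m%:R + 1 <= 5 * n%:R :> R by rewrite natr1 -natrM ler_nat.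
have nR : 2 <= n%:R :> R by rewrite ler_nat.
have sb (k : R) : 5 * n%:R + 2 <= k * (4 * n%:R - 2) ->
    den_ratio quotb n * (m%:R + 3) <= k.
  move=> hk; have m52 : m%:R + 3 <= 5 * n%:R + 2 :> R by clear -mR; lra.
  apply: (le_trans (ler_wpM2l s0 (le_trans m52 hk))).
  rewrite mulrCA -[leRHS]mulr1; apply: ler_wpM2l => //.
  by rewrite -(@pmulr_lge0 _ (4 * n%:R - 2)); [apply: le_trans hk|]; clear -nR; lra.
rewrite bE cE; case: ifP => hm /andP[w1 w2]; rewrite !natrD in tl *.
  apply: quotb_margin3 => //.
  - have : (7 <= m)%N by clear -m1 n2; lia.
    by rewrite -(ler_nat R); clear; lra.
  - by apply: sb; clear -nR; lra.
  - apply: (le_trans tl); apply: ler_wpM2l => //; clear -mr' w2; lra.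
(* At n = 2 the value of the ratio selects the difference 3. *)
have n3 : (3 <= n)%N.
  rewrite ltn_neqAle n2 andbT; apply/eqP => n2E; move: bE hm.
  rewrite -n2E (_ : quotb 3 = 11%N); last by case: quotbc3.
  by clear; lia.
have n3R : 3 <= n%:R :> R by rewrite ler_nat.
apply: quotb_margin2 => //.
- have : (13 <= m)%N by clear -hm n3; lia.
  by rewrite -(ler_nat R); clear; lra.
- have := sb (17/10); move=> /(_ _) h; rewrite mulrC -ler_pdivlMr//; apply: h.
  clear -n3R; lra.
- apply: (le_trans tl); apply: ler_wpM2l => //; clear -mr' w2; lra.
Qed.

Lemma sq_ratioE n : Q n ^+ 2 = sq_ratio n * q n ^+ 2.
Proof. by rewrite /sq_ratio expr_div_n divfK// expf_neq0// gt_eqF// (den_gt0R _ quotb_pos). Qed.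

(** For n = 0 and n = 1 the numerical values of the denominators suffice. *)
Lemma quotb_condition n :
  (q n.+1 - q n) * (q n.+1 + t n.+1 * q n)
     < (1 + t n.+1) * (Q n * (Q n.+1 + T n.+1 * Q n)).
Proof.
have /andP[t0 t1] := @cf_tail_itv R quotb n.+1 quotb_pos.
have /andP[T0 T1] := @cf_tail_itv R quotc n.+1 quotc_pos.
have [d1 d2 D1 D2] := den_initial.
case: n t0 t1 T0 T1 => [|[|n]] t0 t1 T0 T1.
- rewrite (_ : den quotb 0 = 1%N)// (_ : den quotc 0 = 1%N)// d1 D1; nra.
- rewrite d1 d2 D1 D2; nra.
have q0 := @den_gt0R R _ n.+2 quotb_pos.
have Q0 := @den_gt0R R _ n.+2 quotc_pos.
have qE : q n.+3 = ((quotb n.+3)%:R + den_ratio quotb n.+2) * q n.+2.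
  by rewrite denSR mulrDl /den_ratio divfK// gt_eqF.
have := @quotb_condition_ratio n.+2 isT; rewrite -(ltr_pM2r (exprn_gt0 2 q0)) => h.
have -> : (q n.+3 - q n.+2) * (q n.+3 + t n.+3 * q n.+2) =
    ((quotb n.+3)%:R + den_ratio quotb n.+2 - 1) *
    ((quotb n.+3)%:R + den_ratio quotb n.+2 + t n.+3) * q n.+2 ^+ 2.
  by rewrite qE; ring.
apply: (lt_le_trans h); rewrite -mulrA; apply: ler_wpM2l; first by lra.
have [m /andP[mr _] [bE _]] := @quotbc_floor n.+2 isT.
apply: (@le_trans _ _ ((quotc n.+3)%:R * Q n.+2 ^+ 2)).
  rewrite -mulrA sq_ratioE; apply: ler_wpM2l => //.
  by apply: ler_wpM2r; rewrite ?exprn_ge0// bE natrD addrK.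
rewrite expr2 mulrCA; apply: ler_wpM2l; first exact: ltW.
by rewrite [Q n.+3]denSR -addrA lerDl addr_ge0// mulr_ge0// ltW.
Qed.

(** The case n = 0 is numerical; the other cases are about the rule at index
    n + 1, whence the shift by one of the invariants that are used. *)
Lemma quotc_condition n :
  (Q n.+1 + Q n) * (Q n.+1 + T n.+1 * Q n)
     < (1 - T n.+1) * (q n.+1 * (q n.+2 + t n.+2 * q n.+1)).
Proof.
have /andP[t0 t1] := @cf_tail_itv R quotb n.+2 quotb_pos.
have [T0 Tc] := @cf_tail_upper n.+1.
have [d1 d2 D1 D2] := den_initial.
case: n t0 t1 T0 Tc => [|n] t0 t1 T0 Tc.
  rewrite (_ : quotc 2 = 9%N)// in Tc.
  rewrite (_ : den quotc 0 = 1%N)// d1 d2 D1; nra.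
have q0 := @den_gt0R R _ n.+2 quotb_pos.
have Q0 := @den_gt0R R _ n.+2 quotc_pos.
have [_ _ r1 r2 rc] := @sq_ratio_itv n.+2 isT.
have [/andP[s0 s6] _] := @den_ratio_quotb n.+2 isT.
have sg0 := @den_ratio_ge0 quotc n.+2.
have sgs := @den_ratio_cross n.+2.
have sgc := @den_ratio_bound _ n.+1 quotc_pos.
have [m /andP[mr1 mr2] [bE cE]] := @quotbc_floor n.+2 isT.
have r0 : 0 <= sq_ratio n.+2 :> R by exact: le_trans mr1.
have c5 : (m + 5 <= quotc n.+3)%N by rewrite cE; case: ifP; clear; lia.
have Tr : T n.+2 * (sq_ratio n.+2 + 4) <= 1.
  apply: le_trans Tc; apply: ler_wpM2l; first exact: ltW.
  rewrite -(ler_nat R) natrD in c5; apply: le_trans c5; clear -mr2; lra.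
have T1 : T n.+2 <= 1 by have /andP[] := @cf_tail_itv R quotc n.+2 quotc_pos.
have := quotc_margin r0 rc sg0 sgs s6 sgc T0 Tr.
rewrite -(ltr_pM2r (exprn_gt0 2 q0)) => h.
have QE : Q n.+1 = den_ratio quotc n.+2 * Q n.+2.
  by rewrite /den_ratio divfK ?den_prevS// gt_eqF.
have -> : (Q n.+2 + Q n.+1) * (Q n.+2 + T n.+2 * Q n.+1) =
    sq_ratio n.+2 * ((1 + den_ratio quotc n.+2) * (1 + T n.+2 * den_ratio quotc n.+2))
      * q n.+2 ^+ 2.
  by rewrite mulrAC -sq_ratioE QE; ring.
apply: (lt_le_trans h); rewrite -mulrA; apply: ler_wpM2l; first by rewrite subr_ge0.
rewrite expr2 mulrCA; apply: ler_wpM2l; first exact: ltW.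
have -> : q n.+3 = ((quotb n.+3)%:R + den_ratio quotb n.+2) * q n.+2.
  by rewrite denSR mulrDl /den_ratio divfK// gt_eqF.
rewrite -mulrDl; apply: ler_wpM2r; first exact: ltW.
rewrite bE natrD; clear -mr2 t0; lra.
Qed.

(** With rho = Q_n / q_n, both quotients are at most 1/rho, the first one
    because b_(n+1) > rho^2; and rho^2 >= 4n - 1 is unbounded. *)
Lemma den_quotients_small (M : nat) : exists n, M%:R *
  (Q n / q n.+1 + q n / Q n.+1) < 1.
Proof.
pose n := (M ^ 2).+2; exists n.
have n2 : (2 <= n)%N by [].
have [_ _ r1 _ _] := @sq_ratio_itv n n2.
have [m /andP[_ mr] [bE _]] := @quotbc_floor n n2.
have q0 := @den_gt0R R _ n quotb_pos; have q1 := @den_gt0R R _ n.+1 quotb_pos.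
have Q0 := @den_gt0R R _ n quotc_pos; have Q1 := @den_gt0R R _ n.+1 quotc_pos.
pose rho : R := Q n / q n.
have rho0 : 0 < rho by rewrite divr_gt0.
have Mrho : M%:R * 2 <= rho.
  rewrite -(ler_pXn2r (_ : 0 < 2)%N) ?nnegrE ?mulr_ge0 ?(ltW rho0)//.
  apply: le_trans r1; rewrite exprMn -natrX /n -!natr1.
  by rewrite expr2; lra.
have x1 : rho * (Q n / q n.+1) < 1.
  rewrite /rho mulrACA -invfM ltr_pdivrMr ?mulr_gt0// mul1r -expr2 sq_ratioE.
  rewrite expr2 mulrCA ltr_pM2l// denSR bE natrD.
  apply: (@lt_le_trans _ _ ((m%:R + 3) * q n)); last by rewrite lerDl.
  by rewrite ltr_pM2r//; clear -mr; lra.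
have y1 : rho * (q n / Q n.+1) <= 1.
  rewrite /rho mulrA divfK ?gt_eqF// ler_pdivrMr// mul1r denSR.
  apply: (@le_trans _ _ ((quotc n.+1)%:R * Q n)); last by rewrite lerDl.
  by rewrite ler_peMl ?(ltW Q0)// ler1n quotc_pos.
have z0 : 0 <= Q n / q n.+1 + q n / Q n.+1 by rewrite addr_ge0// divr_ge0.
have := ler_wpM2r z0 Mrho.
by move: x1 y1; clear; lra.
Qed.

Lemma cf_value_le a : pos_quotients a -> cf_value a * (a 1%N)%:R <= 1 :> R.
Proof.
move=> ha; have /andP[t0 _] := @cf_tail_itv R a 1 ha.
have a0 : 0 < (a 1%N)%:R :> R by rewrite ltr0n ha.
rewrite -[cf_value a]/(cf_tail a 0) cf_tailS// ler_pdivrMl ?ltr_pwDl//.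
by rewrite mulr1 lerDl.
Qed.

End Invariants.

Theorem theorem7 (R : realType) :
  exists alpha : R,
    [/\ 0 <= alpha <= 1,
        irrational alpha &
        exists b c : nat -> nat,
          shulga_sequences alpha b c /\
          forall n : nat, (1 <= n)%N ->
            (4 * n - 2 <= b n)%N /\ (b n < c n)%N /\ (c n < 5 * n)%N].
Proof.
have irr : irrational (cf_value quotb + cf_value quotc : R).
  by apply: irrational_sum_cf; [exact: quotb_pos|exact: quotc_pos|
    exact: den_quotients_small].
exists (cf_value quotb + cf_value quotc); split => //.
- have [_ /andP[b0 _]] := @cf_value_itv R _ quotb_pos.
  have [_ /andP[c0 _]] := @cf_value_itv R _ quotc_pos.
  have := @cf_value_le R _ quotb_pos; have := @cf_value_le R _ quotc_pos.
  rewrite (_ : quotb 1 = 2%N)// (_ : quotc 1 = 4%N)// => hc hb.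
  by apply/andP; split; lra.
- exists quotb, quotc; split.
    apply: shulga_sequences_of_bounds => //.
    + exact: quotb_gt1.
    + exact: quotc_pos.
    + exact: quotb_condition.
    + exact: quotc_condition.
  move=> n n1; have bc := quotb_lt_quotc n1.
  move: n1; rewrite leq_eqVlt => /orP[/eqP <- //|n2].
  by have [] := @sq_ratio_itv R n n2.
Qed.
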